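(* Let $(X,\mathcal{T})$ be a topological space with a semi-flow $\varphi$, and let $(\mathcal{X},\mathbf{cl},|\cdot|)$ be a Boolean CA-discretization of $(X,\mathcal{T})$ with specialization pre-order $\le$ and set of top cells $\mathcal{X}^\top$. Suppose $(\mathcal{X}^\top,\le^\top)$ is a pre-order, with associated closure operator $\mathbf{cl}^\top$ on subsets of $\mathcal{X}^\top$, satisfying $$\varphi\bigl(t,\mathrm{cl}|\xi|\bigr)\subset \mathrm{int}\,\bigl(\mathrm{cl}\,|\mathbf{cl}^\top\xi|\bigr)\qquad\text{for all } t>0 \text{ and all } \xi\in\mathcal{X}^\top.$$ Then the restriction $\mathbf{cl}\colon \mathsf{O}(\mathcal{X}^\top,\le^\top)\to\mathsf{O}(\mathcal{X},\le)$, $\mathcal{U}\mapsto \mathbf{cl}\,\mathcal{U}$, is an injective lattice homomorphism with $j\circ\mathbf{cl}=\mathrm{id}$, where $j\colon\mathsf{O}(\mathcal{X},\le)\to\mathsf{Set}(\mathcal{X}^\top)$ is given by $j(\mathcal{U})=\mathcal{U}\cap\mathcal{X}^\top$.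
   Context: Semi-flow: a continuous map $\varphi\colon[0,\infty)\times X\to X$ with $\varphi(0,x)=x$ and $\varphi(t,\varphi(s,x))=\varphi(t+s,x)$. $\mathrm{cl}$ and $\mathrm{int}$ denote closure and interior in $(X,\mathcal{T})$, and $\mathsf{Set}(\cdot)$ denotes the power set. CA-discretization: $\mathcal{X}$ is a finite set, $|\cdot|\colon \mathsf{Set}(\mathcal{X})\to\mathsf{Set}(X)$ is an injective Boolean homomorphism of power sets (write $|\xi|:=|\{\xi\}|$), and $\mathbf{cl}$ is a (Kuratowski) closure operator on $\mathsf{Set}(\mathcal{X})$ with $\mathrm{cl}|\mathcal{U}|\subset|\mathbf{cl}\,\mathcal{U}|$ for all $\mathcal{U}\subset\mathcal{X}$. It is Boolean if $\mathrm{cl}|\mathcal{U}|=|\mathbf{cl}\,\mathcal{U}|$ for all $\mathcal{U}\subset\mathcal{X}$. The specialization pre-order is $\xi\le\xi'$ iff $\xi\in\mathbf{cl}\{\xi'\}$, so $\mathbf{cl}\,\mathcal{U}=\{\xi\mid \xi\le\xi'\text{ for some }\xi'\in\mathcal{U}\}$. Top cells: $\mathcal{X}^\top$ is the set of maximal elements of $\mathcal{X}$ with respect to $\le$, i.e. $\xi\in\mathcal{X}^\top$ iff $\{\eta\in\mathcal{X}\mid\xi\le\eta\}=\{\xi\}$. For a pre-order $(\mathcal{P},\preceq)$, $\mathsf{O}(\mathcal{P},\preceq)$ is the bounded distributive lattice of down-sets, with operations $\cap$ and $\cup$. Homomorphisms of bounded lattices are required to preserve the least and greatest elements. For $\mathcal{U}\subset\mathcal{X}^\top$,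 $\mathbf{cl}^\top\mathcal{U}=\{\xi\in\mathcal{X}^\top\mid\xi\le^\top\xi'\text{ for some }\xi'\in\mathcal{U}\}$, and $\mathbf{cl}^\top\xi=\mathbf{cl}^\top\{\xi\}$.
   Formalization: Preservation of the greatest element, cl(𝒳^⊤)=𝒳, is asserted only when every cell with nothing strictly above it is a top cell (automatic if ≤ is a partial order); it fails otherwise, e.g. for two indiscrete points with the identity flow, where 𝒳^⊤ is empty. *)

(* Defs.v *)
From mathcomp Require Import all_boot all_order all_algebra.
From mathcomp Require Import all_classical all_reals all_analysis.

Set Implicit Arguments.
Unset Strict Implicit.
Unset Printing Implicit Defensive.

Import Order.TTheory GRing.Theory Num.Theory.
Import numFieldNormedType.Exports.

Local Open Scope ring_scope.

(* [phi] is a function on all of [R * X]; its values at negative times are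
   unconstrained, and continuity is that of the restriction to [0, +oo[ * X. *)
Record is_semiflow (R : realType) (X : topologicalType) (phi : R -> X -> X)
    : Prop := IsSemiflow {
  semiflow_continuous :
    ({within [set p : R * X | 0 <= p.1],
      continuous (fun p : R * X => phi p.1 p.2)})%classic ;
  semiflow0 : forall x : X, phi 0 x = x ;
  semiflowD : forall (s t : R) (x : X), 0 <= s -> 0 <= t ->
    phi t (phi s x) = phi (t + s) x }.

Record is_boolean_hom (T : finType) (X : Type) (h : {set T} -> set X)
    : Prop := IsBooleanHom {
  boolean_hom0 : h finset.set0 = classical_sets.set0 ;
  boolean_homT : h [set: T]%SET = classical_sets.setT ;
  boolean_homU : forall U V : {set T}, h (U :|: V) = (h U `|` h V)%classic ;
  boolean_homI : forall U V : {set T}, h (U :&: V) = (h U `&` h V)%classic ;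
  boolean_homC : forall U : {set T}, h (~: U) = (~` h U)%classic }.

Record is_kuratowski (T : finType) (cl : {set T} -> {set T})
    : Prop := IsKuratowski {
  kuratowski0 : cl finset.set0 = finset.set0 ;
  kuratowski_ext : forall U : {set T}, U \subset cl U ;
  kuratowski_idem : forall U : {set T}, cl (cl U) = cl U ;
  kuratowskiU : forall U V : {set T}, cl (U :|: V) = cl U :|: cl V }.

Record is_CA_discretization (X : topologicalType) (T : finType)
    (cl : {set T} -> {set T}) (real : {set T} -> set X)
    : Prop := IsCADiscretization {
  CA_boolean_hom : is_boolean_hom real ;
  CA_inj : injective real ;
  CA_kuratowski : is_kuratowski cl ;
  CA_closure : forall U : {set T}, (closure (real U) `<=` real (cl U))%classic }.

Record is_boolean_CA_discretization (X : topologicalType) (T : finType)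
    (cl : {set T} -> {set T}) (real : {set T} -> set X)
    : Prop := IsBooleanCADiscretization {
  boolean_CA : is_CA_discretization cl real ;
  boolean_CA_closure : forall U : {set T}, closure (real U) = real (cl U) }.

Section Order.
Variable T : finType.
Implicit Types (A U V : {set T}) (r : rel T) (cl f : {set T} -> {set T}).

(* A pre-order on the subset [A]; [r] is irrelevant outside of [A]. *)
Definition preorder_on A r : Prop :=
  {in A, reflexive r} /\ {in A & &, transitive r}.

Definition specialization cl : rel T := fun x y => x \in cl [set y]%SET.

Definition top_cells cl : {set T} :=
  [set x | [set y | specialization cl x y]%SET == [set x]%SET]%SET.

Definition closure_on A r U : {set T} :=
  [set x in A | [exists y in U, r x y]]%SET.

Definition downsets A r : {set {set T}} :=
  [set U : {set T} | (U \subset A) &&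
     [forall x in A, forall y in U, r x y ==> (x \in U)]]%SET.

Definition lattice_hom A r B s f : Prop :=
  [/\ {in downsets A r, forall U, f U \in downsets B s},
      {in downsets A r &, {morph f : U V / U :&: V}} &
      {in downsets A r &, {morph f : U V / U :|: V}}].

(* [set0] and [A] are the least and greatest elements of [downsets A r]. *)
Definition bounded_lattice_hom A r B s f : Prop :=
  [/\ lattice_hom A r B s f, f finset.set0 = finset.set0 & f A = B].

(* [j] of the section property, with values in the subsets of [top_cells cl]. *)
Definition top_part cl U : {set T} := U :&: top_cells cl.

(* Maximality in the usual sense of pre-orders: nothing lies strictly above
   [x]. Every element of [top_cells cl] is maximal in this sense; the converse
   holds when the specialization pre-order is antisymmetric, but fails as soon
   as two distinct maximal elements lie below each other. *)
Definition preorder_maximal r (x : T) : Prop := forall y, r x y -> r y x.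

(* Equivalent to [cl (top_cells cl)] being the whole of [T], hence necessary for
   [cl] to map the greatest down-set of top cells to the greatest down-set of
   [T]: for an indiscrete pair of cells, [top_cells cl] is empty. *)
Definition maximal_cells_are_top cl : Prop :=
  forall x, preorder_maximal (specialization cl) x -> x \in top_cells cl.

End Order.

(* Main.v *)
(* If a cell [x] lies in [cl U] and in [cl V] for two down-sets of top cells, the
   flow pushes a point of [|x|] at once into the interiors of [|cl U|] and of
   [|cl V|]. A point of both interiors is a limit of points of a top cell of [U],
   and this cell meets [|cl V|], hence belongs to [V] by maximality; so the orbit
   lies in the closed set [|cl (U :&: V)|] at all positive times, and letting the
   time tend to 0, [x] belongs to [cl (U :&: V)]. *)
Require Import Defs.
From mathcomp Require Import all_boot all_order all_algebra.
From mathcomp Require Import all_classical all_reals all_analysis.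

Set Implicit Arguments.
Unset Strict Implicit.
Unset Printing Implicit Defensive.

Import Order.TTheory GRing.Theory Num.Theory.
Import numFieldNormedType.Exports.

Local Open Scope ring_scope.

Lemma finset_bigcup1 (T : finType) (U : {set T}) :
  (\bigcup_(y in U) [set y]%SET)%SET = U.
Proof.
apply/finset.setP => z; apply/finset.bigcupP/idP => [[y yU]|zU].
  by rewrite inE => /eqP ->.
by exists z; rewrite ?inE.
Qed.

Section Closure.
Variables (T : finType) (cl : {set T} -> {set T}).
Hypothesis clP : is_kuratowski cl.
Implicit Types (U V : {set T}) (x y : T).
Local Notation le := (specialization cl).

Lemma kuratowski_mono U V : U \subset V -> cl U \subset cl V.
Proof.
by move=> /finset.setUidPr <-; rewrite (kuratowskiU clP) finset.subsetUl.
Qed.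

(** By additivity and finiteness, [cl U] is the union of the closures of the points of [U], so [cl]
    is determined by its specialization pre-order. *)
Lemma mem_kuratowski U x : reflect (exists2 y, y \in U & le x y) (x \in cl U).
Proof.
apply: (iffP idP) => [|[y yU]]; last first.
  by apply: (fintype.subsetP (kuratowski_mono _)); rewrite finset.sub1set.
have clE : cl (\bigcup_(y in U) [set y]%SET) = (\bigcup_(y in U) cl [set y])%SET.
  by apply: big_morph; [exact: (kuratowskiU clP) | exact: (kuratowski0 clP)].
by rewrite -{1}(finset_bigcup1 U) clE => /finset.bigcupP[y yU xy]; exists y.
Qed.

Lemma specialization_refl : reflexive le.
Proof. by move=> x; rewrite /specialization -finset.sub1set (kuratowski_ext clP). Qed.

Lemma specialization_trans : transitive le.
Proof.
move=> y x z xy yz; rewrite /specialization -(kuratowski_idem clP).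
by apply/mem_kuratowski; exists y.
Qed.

Lemma kuratowski_downset U : cl U \in downsets [set: T]%SET le.
Proof.
rewrite inE finset.subsetT /=.
apply/forall_inP => x _; apply/forall_inP => y yU; apply/implyP => xy.
by rewrite -(kuratowski_idem clP); apply/mem_kuratowski; exists y.
Qed.

Lemma top_cells_le x y : x \in top_cells cl -> le x y -> y = x.
Proof.
rewrite inE => /eqP/finset.setP/(_ y); rewrite !inE => yx xy.
by apply/eqP; rewrite -yx.
Qed.

(** A top cell lies below no cell but itself, so closing [U] adds no new top cell. *)
Lemma top_part_kuratowski U : U \subset top_cells cl -> top_part cl (cl U) = U.
Proof.
move=> /fintype.subsetP UA; apply/finset.setP => x; rewrite finset.in_setI.
apply/andP/idP => [[/mem_kuratowski[y yU xy] /top_cells_le xtop]|xU].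
  by rewrite -(xtop _ xy).
by split; [exact: (fintype.subsetP (kuratowski_ext clP U)) | exact: UA].
Qed.

(** Since [T] is finite, some [y] above [x] has an up-set of least cardinality. The up-set of any
    [z] above [y] lies in that of [y], so equals it by minimality, and hence contains [y]. *)
Lemma le_preorder_maximal x : exists2 y, preorder_maximal le y & le x y.
Proof.
pose up y := [set z | le y z]%SET.
have xx := specialization_refl x.
case: (@arg_minnP _ x (le x) (fun y => #|up y|) xx) => y xy ymin.
exists y => // z yz.
have sub : up z \subset up y.
  by apply/fintype.subsetP => w; rewrite !inE; exact: specialization_trans.
have /eqP upE : up z == up y.
  by rewrite eqEcard sub ymin ?(specialization_trans xy).
have : y \in up z by rewrite upE inE specialization_refl.
by rewrite inE.
Qed.

(** Every cell lies below a maximal one; this is how [cl] preserves the greatest element. *)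
Lemma kuratowski_top_cells :
  maximal_cells_are_top cl -> cl (top_cells cl) = [set: T]%SET.
Proof.
move=> maxtop; apply/finset.setP => x; rewrite finset.in_setT.
have [y ymax xy] := le_preorder_maximal x.
by apply/mem_kuratowski; exists y => //; exact: maxtop.
Qed.

End Closure.

Section BooleanHom.
Variables (T : finType) (X : Type) (real : {set T} -> set X).
Hypothesis realP : is_boolean_hom real.

Lemma boolean_hom_mono (U V : {set T}) :
  U \subset V -> (real U `<=` real V)%classic.
Proof.
by move=> /finset.setUidPr <- p Up; rewrite (boolean_homU realP); left.
Qed.

Lemma mem_boolean_hom (U : {set T}) (p : X) :
  real U p -> exists2 x, x \in U & real [set x]%SET p.
Proof.
have realE : real (\bigcup_(y in U) [set y]%SET)%SET =
    \big[setU/classical_sets.set0]_(y in U) real [set y]%SET.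
  by apply: big_morph; [exact: (boolean_homU realP) | exact: (boolean_hom0 realP)].
rewrite -{1}(finset_bigcup1 U) realE; elim/big_ind: _ => [//|A B IA IB [/IA|/IB]//|y yU py].
by exists y.
Qed.

(** Otherwise [x] would lie in the complement of [U], whose realization is disjoint from that of
    [U]. *)
Lemma mem_boolean_hom1 (U : {set T}) (x : T) (p : X) :
  real [set x]%SET p -> real U p -> x \in U.
Proof.
move=> xp Up; apply/negPn/negP => xU.
have : real (~: U) p by apply: boolean_hom_mono xp; rewrite finset.sub1set inE.
by rewrite (boolean_homC realP).
Qed.

(** An empty realization would coincide with that of the empty set, against injectivity. *)
Lemma boolean_hom1_neq0 (x : T) : injective real -> exists p, real [set x]%SET p.
Proof.
move=> inj; apply/not_existsP => x0.
have /inj/finset.setP/(_ x) : real [set x]%SET = real finset.set0.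
  by rewrite (boolean_hom0 realP) -subset0 => p /x0.
by rewrite !inE eqxx.
Qed.

End BooleanHom.

Lemma semiflow_closed0 (R : realType) (X : topologicalType) (phi : R -> X -> X)
    (C : set X) (p : X) :
  is_semiflow phi -> closed C -> (forall t, 0 < t -> C (phi t p)) -> C p.
Proof.
move=> phiP Ccl Cphi; apply: contrapT => nCp.
have : nbhs (phi 0 p) (~` C)%classic.
  by rewrite (semiflow0 phiP); apply: open_nbhs_nbhs; split=> //; exact: closed_openC.
have /subspace_continuousP/(_ (0, p) (lexx 0)) := semiflow_continuous phiP.
move=> /[apply].
move=> [[A B] /= [A0 Bp] AB].
move: A0 => /nbhs_ballP[e /= e0 eA].
have e2 : 0 < e / 2 by rewrite divr_gt0.
(* The time [e / 2] is within [e] of 0; its positivity makes [Cphi] applicable and keeps the pair in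
   the domain where continuity is assumed. *)
apply: (AB (e / 2, p)) (Cphi _ e2) => /=; last exact: ltW.
split=> /=; last exact: nbhs_singleton.
apply: eA; rewrite /ball /= sub0r normrN gtr0_norm //.
by rewrite ltr_pdivrMr // ltr_pMr // ltr1n.
Qed.

Section BooleanCADiscretization.
Variables (X : topologicalType) (T : finType).
Variables (cl : {set T} -> {set T}) (real : {set T} -> set X).
Hypothesis discr : is_boolean_CA_discretization cl real.

Lemma interior_kuratowskiI (U V : {set T}) :
  U \subset top_cells cl ->
  (interior (real (cl U)) `&` interior (real (cl V)) `<=`
    real (cl (U :&: V)))%classic.
Proof.
have [[hom _ clP _] clE] := discr.
move=> /fintype.subsetP UA q [/interior_subset qU qV].
have [y /(mem_kuratowski clP)[u uU yu] yq] := mem_boolean_hom hom qU.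
have : closure (real [set u]%SET) q.
  by rewrite clE; apply: (boolean_hom_mono hom) yq; rewrite finset.sub1set.
(* [qV] makes [real (cl V)] a neighbourhood of [q], so it meets the realization of [u]. *)
move=> /(_ _ qV)[r [ur Vr]].
have /(mem_kuratowski clP)[v vV uv] := mem_boolean_hom1 hom ur Vr.
(* The top cell [u] lies below [v], so it equals [v] and belongs to [V]. *)
have uIV : u \in U :&: V.
  by rewrite finset.in_setI uU -(top_cells_le (UA _ uU) uv).
apply: (boolean_hom_mono hom) yq; rewrite finset.sub1set.
by apply/(mem_kuratowski clP); exists u.
Qed.

Lemma kuratowskiI_downsets (R : realType) (phi : R -> X -> X) (leT : rel T) :
  is_semiflow phi ->
  (forall (t : R) (xi : T), 0 < t -> xi \in top_cells cl ->
     (phi t @` closure (real [set xi]%SET) `<=`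
      interior (closure (real (closure_on (top_cells cl) leT [set xi]%SET))))%classic) ->
  {in downsets (top_cells cl) leT &, {morph cl : U V / U :&: V}}.
Proof.
have [[hom inj clP _] clE] := discr.
move=> phiP phi_leT.
(* A cell of [cl U] lies below a top cell [u] of [U], so its points are in the closure of the
   realization of [u], where [phi_leT] applies. *)
have flow U t x p : U \in downsets (top_cells cl) leT -> x \in cl U ->
    real [set x]%SET p -> 0 < t -> interior (real (cl U)) (phi t p).
  rewrite inE => /andP[/fintype.subsetP UA /forall_inP Udown].
  move=> /(mem_kuratowski clP)[u uU xu] xp t0.
  have : interior (closure (real (closure_on (top_cells cl) leT [set u]%SET)))
      (phi t p).
    apply: (phi_leT _ _ t0 (UA _ uU)); exists p => //.
    by rewrite clE; apply: (boolean_hom_mono hom) xp; rewrite finset.sub1set.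
  (* The down-set [U] contains the [leT]-closure of [u], so monotonicity concludes. *)
  rewrite clE; apply: interiorS; apply: (boolean_hom_mono hom).
  apply: (kuratowski_mono clP); apply/fintype.subsetP => y; rewrite inE.
  move=> /andP[yA /exists_inP[w]]; rewrite inE => /eqP -> yu.
  by have /forall_inP/(_ u uU)/implyP := Udown y yA; apply.
move=> U V Ud Vd; apply/eqP; rewrite finset.eqEsubset finset.subsetI.
(* Monotonicity gives one inclusion; the dynamics serves the converse. *)
rewrite !(kuratowski_mono clP) ?finset.subsetIl ?finset.subsetIr //=.
apply/fintype.subsetP => x /finset.setIP[xU xV].
(* A single point [p] of the cell [x] decides membership, so it is enough to follow its orbit. *)
have [p xp] := boolean_hom1_neq0 hom x inj.
apply: (mem_boolean_hom1 hom xp); apply: (semiflow_closed0 phiP).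
  (* The Boolean condition turns the realization of a closure into a topological closure. *)
  by rewrite -clE; exact: closed_closure.
move=> t t0; apply: interior_kuratowskiI.
  by move: Ud; rewrite inE => /andP[].
by split; [exact: flow xU xp t0 | exact: flow xV xp t0].
Qed.

End BooleanCADiscretization.

Theorem theorem3p28 (R : realType) (X : topologicalType) (phi : R -> X -> X)
  (phi_semiflow : is_semiflow phi)
  (T : finType) (cl : {set T} -> {set T}) (real : {set T} -> set X)
  (discr : is_boolean_CA_discretization cl real)
  (leT : rel T) (leT_preorder : preorder_on (top_cells cl) leT)
  (phi_leT : forall (t : R) (xi : T), 0 < t -> xi \in top_cells cl ->
     (phi t @` closure (real [set xi]%SET) `<=`
      interior (closure (real (closure_on (top_cells cl) leT [set xi]%SET))))%classic) :
  [/\ lattice_hom (top_cells cl) leT [set: T]%SET (specialization cl) cl,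
      cl finset.set0 = finset.set0,
      maximal_cells_are_top cl ->
      bounded_lattice_hom (top_cells cl) leT [set: T]%SET (specialization cl) cl,
      {in downsets (top_cells cl) leT &, injective cl} &
      {in downsets (top_cells cl) leT, forall U, top_part cl (cl U) = U}].
Proof.
have [[hom inj clP _] clE] := discr.
have topK : {in downsets (top_cells cl) leT, forall U, top_part cl (cl U) = U}.
  by move=> U; rewrite inE => /andP[UA _]; exact: top_part_kuratowski.
have lat : lattice_hom (top_cells cl) leT [set: T]%SET (specialization cl) cl.
  split; first by move=> U _; exact: kuratowski_downset.
    exact: kuratowskiI_downsets phi_semiflow phi_leT.
  by move=> U V _ _; exact: (kuratowskiU clP).
have cl0 := kuratowski0 clP.
split=> //; first by move=> maxtop; split=> //; exact: kuratowski_top_cells.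
by move=> U V Ud Vd eUV; rewrite -(topK U Ud) -(topK V Vd) eUV.
Qed.
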